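(* Let $\mathbb{I}=(I,\le,\mathcal{I})$ be a set of indices and let $\mathcal{B},\mathcal{B}',\mathcal{Z}'$ be asymptotic gauges on $\mathbb{I}$ such that $$\mathbb{R}_M\left(e^{\mathcal{B}}\right)\subseteq\mathbb{R}_M(\mathcal{B}')\subseteq\mathbb{R}_M(\mathcal{Z}').$$ Let $d\in\mathbb{N}_{>0}$, $t_0\in\mathbb{R}$, $c\in\widetilde{\mathbb{R}}(\mathcal{B}',\mathcal{Z}')^d$ and let $A$ be a $d\times d$ matrix with entries in the ring $\widetilde{\mathbb{R}}(\mathcal{B}',\mathcal{Z}')$. Assume that both $c$ and $A$ are bounded by $\mathcal{B}$. Then the problem $$x'(t)+A\cdot x(t)=0,\qquad x(t_0)=c$$ has a unique solution $x$ in $\mathcal{G}(\mathcal{B}',\mathcal{Z}',\mathbb{R})^d$.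
   Context: $\mathbb{N}$ includes $0$. A set of indices is a triple $\mathbb{I}=(I,\le,\mathcal{I})$ such that: (a) $I$ is a nonempty set and $\le$ is a reflexive and transitive relation on $I$; (b) $\mathcal{I}$ is a set of subsets of $I$ with $\emptyset\notin\mathcal{I}$ and $I\in\mathcal{I}$; (c) for all $A,B\in\mathcal{I}$ there is $C\in\mathcal{I}$ with $C\subseteq A\cap B$; (d) writing $(\emptyset,e]:=\{\varepsilon\in I\mid\varepsilon\le e\}$, $A_{\le e}:=(\emptyset,e]\cap A$, and $\varepsilon<e$ for ''$\varepsilon\le e$ and $\varepsilon\ne e$'': whenever $e\le a\in A\in\mathcal{I}$, the set $A_{\le e}$ is nonempty and for all $b,c\in A_{\le e}$ there is $d\in A_{\le e}$ with $d<b$ and $d<c$. A net is a map $x:I\to\mathbb{R}$, written $(x_\varepsilon)$. Big-O: for $a\in A\in\mathcal{I}$, $x_\varepsilon=O_{a,A}(y_\varepsilon)$ means $\exists H\in\mathbb{R}_{>0}\,\exists\varepsilon_0\in A_{\le a}\,\forall\varepsilon\in A_{\le\varepsilon_0}:|x_\varepsilon|\le H|y_\varepsilon|$; and $x_\varepsilon=O(y_\varepsilon)$ means $\exists A\in\mathcal{I}\,\forall a\in A: x_\varepsilon=O_{a,A}(y_\varepsilon)$. For a property $\mathcal{P}$, $\forall^{\mathbb{I}}\varepsilon:\mathcal{P}(\varepsilon)$ means $\exists A\in\mathcal{I}\,\forall a\in A\,\exists e\le a\,\forall\varepsilon\in A_{\le e}:\mathcal{P}(\varepsilon)$. For nets,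 $i>_{\mathbb{I}}j$ means $\forall^{\mathbb{I}}\varepsilon: i_\varepsilon>j_\varepsilon$. $\lim_{\mathbb{I}}f=\infty$ means $\exists A\in\mathcal{I}\,\forall a\in A\,\forall r>0\,\exists a_0\le a\,\forall\varepsilon\in A_{\le a_0}:|f_\varepsilon|>r$. An asymptotic gauge (AG) on $\mathbb{I}$ is a set $\mathcal{B}\subseteq\mathbb{R}^I$ such that: $\exists i\in\mathcal{B}:\lim_{\mathbb{I}}i=\infty$; $\forall i,j\in\mathcal{B}\,\exists p\in\mathcal{B}: i\cdot j=O(p)$; $\forall i\in\mathcal{B}\,\forall r\in\mathbb{R}\,\exists\sigma\in\mathcal{B}: r\cdot i=O(\sigma)$; $\forall i,j\in\mathcal{B}\,\exists s\in\mathcal{B}: s>_{\mathbb{I}}0$ and $|i|+|j|=O(s)$. Put $\mathcal{B}_{>0}:=\{i\in\mathcal{B}\mid i>_{\mathbb{I}}0\}$, $\mathbb{R}_M(\mathcal{B}):=\{x\in\mathbb{R}^I\mid\exists b\in\mathcal{B}: x_\varepsilon=O(b_\varepsilon)\}$, and $e^{\mathcal{B}}:=\{(e^{H b_\varepsilon})\mid H\in\mathbb{R}_{>0},\,b\in\mathcal{B}\}$, which is again an AG. For $\Omega\subseteq\mathbb{R}^n$ open: $\mathcal{E}_M(\mathcal{B},\Omega)$ is the set of $u=(u_\varepsilon)\in\mathcal{C}^\infty(\Omega)^I$ such that for all compact $K\subseteq\Omega$ and $\alpha\in\mathbb{N}^n$ there is $b\in\mathcal{B}$ with $\sup_{x\in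 K}|\partial^\alpha u_\varepsilon(x)|=O(b_\varepsilon)$; $\mathcal{N}(\mathcal{Z},\Omega)$ is the set of $u\in\mathcal{C}^\infty(\Omega)^I$ such that for all compact $K\subseteq\Omega$, $\alpha\in\mathbb{N}^n$ and all $z\in\mathcal{Z}_{>0}$, $\sup_{x\in K}|\partial^\alpha u_\varepsilon(x)|=O(z_\varepsilon^{-1})$ (only those sufficiently small $\varepsilon$ with $z_\varepsilon>0$ are considered). $\mathcal{G}(\mathcal{B},\mathcal{Z},\Omega):=\mathcal{E}_M(\mathcal{B},\Omega)/\mathcal{N}(\mathcal{Z},\Omega)$, with derivatives and products defined on representatives; it is a differential algebra when $\mathbb{R}_M(\mathcal{B})\subseteq\mathbb{R}_M(\mathcal{Z})$. When $\mathbb{R}_M(\mathcal{B})\subseteq\mathbb{R}_M(\mathcal{Z})$, $\widetilde{\mathbb{R}}(\mathcal{B},\mathcal{Z}):=\mathbb{R}_M(\mathcal{B})/\sim_{\mathcal{Z}}$, where $(x_\varepsilon)\sim_{\mathcal{Z}}(y_\varepsilon)$ iff $x_\varepsilon-y_\varepsilon=O(z_\varepsilon^{-1})$ for all $z\in\mathcal{Z}_{>0}$; this is a ring, identified with the constant generalized functions in $\mathcal{G}(\mathcal{B},\mathcal{Z},\mathbb{R})$. An element of $\widetilde{\mathbb{R}}(\mathcal{B}',\mathcal{Z}')$ is bounded by $\mathcal{B}$ if it has a representative in $\mathbb{R}_M(\mathcal{B})$; vectors and matrices are bounded by $\mathcal{B}$ if all their entries are. For $x=[x_\varepsilon]\in\mathcal{G}(\mathcal{B}',\mathcal{Z}',\mathbb{R})$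 and $t_0\in\mathbb{R}$, $x(t_0):=[x_\varepsilon(t_0)]\in\widetilde{\mathbb{R}}(\mathcal{B}',\mathcal{Z}')$; these operations apply componentwise to vectors. *)

(* Defs.v *)
(* MathComp-Analysis; the real numbers are an arbitrary [R : realType]. *)
From HB Require Import structures.
From mathcomp Require Import all_boot all_order all_algebra.
From mathcomp Require Import all_classical all_reals all_analysis.
From mathcomp Require Export generic_quotient ring_quotient.

Set Implicit Arguments.
Unset Strict Implicit.
Unset Printing Implicit Defensive.

Import Order.TTheory GRing.Theory Num.Theory.
Import numFieldNormedType.Exports.

Local Open Scope classical_set_scope.
Local Open Scope ring_scope.
Local Open Scope quotient_scope.

(* [le_sect le A e] is the set A_{<= e} = (∅, e] ∩ A. *)
Definition le_sect (I : Type) (le : I -> I -> Prop) (A : set I) (e : I) : set I :=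
  [set x | le x e] `&` A.

Record index_set := IndexSet {
  idx :> Type;
  idx_le : idx -> idx -> Prop;
  idx_fam : set (set idx);
  idx_inhabited : inhabited idx;
  idx_le_refl : forall e, idx_le e e;
  idx_le_trans : forall e f g, idx_le e f -> idx_le f g -> idx_le e g;
  idx_fam0 : ~ idx_fam set0;
  idx_famT : idx_fam setT;
  idx_famI : forall A B, idx_fam A -> idx_fam B ->
    exists2 C, idx_fam C & C `<=` A `&` B;
  idx_fam_sect0 : forall A a e, idx_fam A -> A a -> idx_le e a ->
    le_sect idx_le A e !=set0;
  idx_fam_directed : forall A a e, idx_fam A -> A a -> idx_le e a ->
    forall b c, le_sect idx_le A e b -> le_sect idx_le A e c ->
    exists d, [/\ le_sect idx_le A e d,
                  idx_le d b /\ d <> b & idx_le d c /\ d <> c] }.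

Definition sect (I : index_set) (A : set I) (e : I) : set I :=
  le_sect (@idx_le I) A e.

Section Nets.
Variables (R : realType) (I : index_set).
Implicit Types (x y z f : I -> R) (A C : set I) (a e : I).

Definition bigO_at a A x y : Prop :=
  exists H : R, 0 < H /\
  exists2 e0, sect A a e0 & forall e, sect A e0 e -> `|x e| <= H * `|y e|.

Definition bigO x y : Prop :=
  exists2 A, idx_fam A & forall a, A a -> bigO_at a A x y.

(* The quantifier ∀^I; the bound e0 lies in I, not necessarily in A. *)
Definition for_small (P : I -> Prop) : Prop :=
  exists2 A, idx_fam A &
    forall a, A a -> exists2 e0, idx_le e0 a & forall e, sect A e0 e -> P e.

Definition net_gt x y : Prop := for_small (fun e => y e < x e).

Definition lim_infty f : Prop :=
  exists2 A, idx_fam A &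
    forall a, A a -> forall r : R, 0 < r ->
    exists2 a0, idx_le a0 a & forall e, sect A a0 e -> r < `|f e|.

End Nets.

Record asymptotic_gauge (R : realType) (I : index_set) := AsymptoticGauge {
  gauge :> set (I -> R);
  gauge_infty : exists2 i, gauge i & lim_infty i;
  gauge_mul : forall i j, gauge i -> gauge j ->
    exists2 p, gauge p & bigO (fun e => i e * j e) p;
  gauge_scale : forall i (r : R), gauge i ->
    exists2 s, gauge s & bigO (fun e => r * i e) s;
  gauge_add : forall i j, gauge i -> gauge j ->
    exists s, [/\ gauge s, net_gt s (fun=> 0) &
                  bigO (fun e => `|i e| + `|j e|) s] }.

Section ModerateNegligible.
Variables (R : realType) (I : index_set).
Implicit Types (B Z : set (I -> R)).

Definition moderate B : set (I -> R) :=
  [set x | exists2 b, B b & bigO x b].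

Definition exp_gauge B : set (I -> R) :=
  [set x | exists H b, [/\ 0 < H, B b & x = fun e => expR (H * b e)]].

(* For z >_I 0 the set witnessing the big-O may be shrunk so that z e > 0 at
   every e it involves, so the convention 0^-1 = 0 plays no role here. *)
Definition negligible Z : set (I -> R) :=
  [set x | forall z, Z z -> net_gt z (fun=> 0) -> bigO x (fun e => (z e)^-1)].

End ModerateNegligible.

Section NetTheory.
Variables (R : realType) (I : index_set).
Implicit Types (x y z f : I -> R) (A C : set I) (a e : I) (P Q : I -> Prop).

Definition ev_at A a P :=
  exists2 e0, sect A a e0 & forall e, sect A e0 e -> P e.

Lemma sect_sub A C a e : C `<=` A -> idx_le a e -> sect C a `<=` sect A e.
Proof.
by move=> CA ae x [/= xa Cx]; split; [exact: idx_le_trans ae | exact: CA].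
Qed.

Lemma ev_at_and A a P Q : idx_fam A -> A a ->
  ev_at A a P -> ev_at A a Q -> ev_at A a (fun e => P e /\ Q e).
Proof.
move=> fA Aa [b Ab Pb] [c Ac Qc].
have [d [Ad [db _] [dc _]]] := idx_fam_directed fA Aa (idx_le_refl a) Ab Ac.
exists d => // e de; split; [apply: Pb|apply: Qc]; exact: sect_sub de.
Qed.

Lemma ev_at_sub A C a P : idx_fam C -> C `<=` A -> C a ->
  ev_at A a P -> ev_at C a P.
Proof.
move=> fC CA Ca [b [/= ba Ab] Pb].
have [c [/= cb Cc]] := idx_fam_sect0 fC Ca ba.
exists c => [|e ce]; first by split=> //=; exact: idx_le_trans ba.
by apply: Pb; exact: sect_sub ce.
Qed.

Lemma ev_at_ex A a P : idx_fam A -> A a -> ev_at A a P -> exists e, P e.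
Proof.
move=> fA Aa [b [ba Ab] Pb]; exists b; apply: Pb.
by split=> //=; exact: idx_le_refl.
Qed.

Lemma fam_ex A : idx_fam A -> exists a, A a.
Proof.
move=> fA; apply: contrapT => nA; apply: (@idx_fam0 I).
suff <- : A = set0 by [].
by rewrite -subset0 => a Aa; case: nA; exists a.
Qed.

Lemma ev_at_of_le A a e0 P : idx_fam A -> A a -> idx_le e0 a ->
  (forall e, sect A e0 e -> P e) -> ev_at A a P.
Proof.
move=> fA Aa ea Pe; have [c [/= cb Cc]] := idx_fam_sect0 fA Aa ea.
exists c => [|e ce]; first by split=> //=; exact: idx_le_trans ea.
by apply: Pe; exact: sect_sub ce.
Qed.

Lemma bigO_comb x1 y1 x2 y2 P x y : bigO x1 y1 -> bigO x2 y2 -> for_small P ->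
  (forall H1 H2, 0 < H1 -> 0 < H2 -> exists2 H : R, 0 < H &
    forall e, `|x1 e| <= H1 * `|y1 e| -> `|x2 e| <= H2 * `|y2 e| -> P e ->
      `|x e| <= H * `|y e|) ->
  bigO x y.
Proof.
move=> [A1 fA1 h1] [A2 fA2 h2] [A3 fA3 h3] hH.
have [C' fC' sC'] := idx_famI fA1 fA2.
have [C fC sC] := idx_famI fC' fA3.
have s1 : C `<=` A1 by move=> t /sC[/sC'[]].
have s2 : C `<=` A2 by move=> t /sC[/sC'[]].
have s3 : C `<=` A3 by move=> t /sC[].
exists C => // a Ca.
have [H1 [H10 /(ev_at_sub fC s1 Ca) e1]] := h1 _ (s1 _ Ca).
have [H2 [H20 /(ev_at_sub fC s2 Ca) e2]] := h2 _ (s2 _ Ca).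
have [e0 ea0 /(ev_at_of_le fA3 (s3 _ Ca) ea0)/(ev_at_sub fC s3 Ca) e3] :=
  h3 _ (s3 _ Ca).
have [H H0 hHe] := hH _ _ H10 H20; exists H; split=> //.
have [e4 ea4 h4] := ev_at_and fC Ca (ev_at_and fC Ca e1 e2) e3.
by exists e4 => // e /h4[[? ?] ?]; exact: hHe.
Qed.

Lemma for_smallT : for_small (fun _ : I => True).
Proof. by exists setT; [exact: idx_famT | move=> a _; exists a => //; exact: idx_le_refl]. Qed.

Lemma bigO_refl x : bigO x x.
Proof.
exists setT; [exact: idx_famT | move=> a _]; exists 1; split => //.
exists a; last by move=> e _; rewrite mul1r.
by split=> //=; exact: idx_le_refl.
Qed.

Lemma bigO_le P x y : for_small P -> (forall e, P e -> `|x e| <= `|y e|) ->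
  bigO x y.
Proof.
move=> hP h; apply: (bigO_comb (bigO_refl y) (bigO_refl y) hP) => ? ? _ _.
by exists 1 => // e _ _; rewrite mul1r; exact: h.
Qed.

Lemma bigO_trans y x z : bigO x y -> bigO y z -> bigO x z.
Proof.
move=> h1 h2; apply: (bigO_comb h1 h2 for_smallT) => H1 H2 H10 H20.
exists (H1 * H2); first exact: mulr_gt0.
move=> e xy yz _; apply: (le_trans xy); rewrite -mulrA ler_pM2l//.
Qed.

Lemma bigO0 y : bigO (fun=> 0) y.
Proof. by apply: (bigO_le for_smallT) => e _; rewrite normr0. Qed.

Lemma bigOD x1 x2 y : bigO x1 y -> bigO x2 y -> bigO (fun e => x1 e + x2 e) y.
Proof.
move=> h1 h2; apply: (bigO_comb h1 h2 for_smallT) => H1 H2 H10 H20.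
exists (H1 + H2); first exact: addr_gt0.
by move=> e xy yz _; rewrite mulrDl (le_trans (ler_normD _ _))// lerD.
Qed.

Lemma bigOM x1 x2 y1 y2 : bigO x1 y1 -> bigO x2 y2 ->
  bigO (fun e => x1 e * x2 e) (fun e => y1 e * y2 e).
Proof.
move=> h1 h2; apply: (bigO_comb h1 h2 for_smallT) => H1 H2 H10 H20.
exists (H1 * H2); first exact: mulr_gt0.
by move=> e xy yz _; rewrite !normrM mulrACA ler_pM.
Qed.

Lemma lim_infty_gt f (r : R) : lim_infty f -> for_small (fun e => r < `|f e|).
Proof.
move=> [A fA h]; exists A => // a Aa.
have r0 : 0 < Num.max r 1 by rewrite lt_max ltr01 orbT.
have [e0 ea he] := h a Aa _ r0; exists e0 => // e /he; apply: le_lt_trans.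
by rewrite le_max lexx.
Qed.

Lemma lim_infty_nbigO f : lim_infty f -> bigO f (fun=> 1) -> False.
Proof.
move=> [A fA h] [A' fA' h'].
have [C fC sC] := idx_famI fA fA'; have [a Ca] := fam_ex fC.
have [s1 s2] : C `<=` A /\ C `<=` A' by split=> t /sC[].
have [H [H0 /(ev_at_sub fC s2 Ca) e1]] := h' _ (s2 _ Ca).
have [e0 ea0 /(ev_at_of_le fA (s1 _ Ca) ea0)/(ev_at_sub fC s1 Ca) e2] :=
  h _ (s1 _ Ca) _ H0.
have [e []] := ev_at_ex fC Ca (ev_at_and fC Ca e1 e2).
by rewrite normr1 mulr1 => /le_lt_trans /[apply]; rewrite ltxx.
Qed.

End NetTheory.

Section GaugeTheory.
Variables (R : realType) (I : index_set).
Implicit Types (B Z : asymptotic_gauge R I) (S : set (I -> R)) (x y : I -> R).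

Lemma moderate_bigO S x y : bigO x y -> moderate S y -> moderate S x.
Proof. by move=> xy [b Sb yb]; exists b => //; exact: bigO_trans yb. Qed.

Lemma negligible_bigO S x y : bigO x y -> negligible S y -> negligible S x.
Proof. by move=> xy h z Sz z0; apply: bigO_trans xy _; exact: h. Qed.

Lemma moderate1 B : moderate B (fun=> 1).
Proof.
have [i Bi /lim_infty_gt li] := gauge_infty B; exists i => //.
by apply: (bigO_le (li 1)) => e; rewrite normr1 => /ltW.
Qed.

Lemma moderateD B x y : moderate B x -> moderate B y ->
  moderate B (fun e => x e + y e).
Proof.
move=> [i Bi xi] [j Bj yj]; have [s [Bs _ ijs]] := gauge_add Bi Bj.
exists s => //; apply: bigO_trans ijs.
by apply: bigOD; [apply: bigO_trans xi _|apply: bigO_trans yj _];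
  apply: (bigO_le (for_smallT _)) => e _;
  rewrite [leRHS]ger0_norm ?addr_ge0// ?lerDl ?lerDr.
Qed.

Lemma moderateM B x y : moderate B x -> moderate B y ->
  moderate B (fun e => x e * y e).
Proof.
move=> [i Bi xi] [j Bj yj]; have [p Bp ijp] := gauge_mul Bi Bj.
by exists p => //; apply: bigO_trans ijp; exact: bigOM.
Qed.

Lemma negligible0 S : negligible S (fun=> 0).
Proof. by move=> z _ _; exact: bigO0. Qed.

Lemma negligibleD S x y : negligible S x -> negligible S y ->
  negligible S (fun e => x e + y e).
Proof. by move=> hx hy z Sz z0; apply: bigOD; [exact: hx|exact: hy]. Qed.

Lemma negligibleM Z x y : moderate Z x -> negligible Z y ->
  negligible Z (fun e => x e * y e).
Proof.
move=> [b Zb xb] hy z Zz z0.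
have [p Zp bzp] := gauge_mul Zb Zz.
have [s [Zs s0 pps]] := gauge_add Zp Zp.
have xzs : bigO (fun e => x e * z e) s.
  apply: bigO_trans pps; apply: (bigO_trans (bigOM xb (bigO_refl z))).
  apply: (bigO_trans bzp); apply: (bigO_le (for_smallT _)) => e _.
  by rewrite [leRHS]ger0_norm ?addr_ge0// lerDl.
have xs : bigO x (fun e => s e / z e).
  apply: (bigO_trans _ (bigOM xzs (bigO_refl (fun e => (z e)^-1)))).
  by apply: (bigO_le z0) => e ze; rewrite mulfK// gt_eqF.
apply: (bigO_trans (bigOM xs (hy s Zs s0))).
by apply: (bigO_le s0) => e se; rewrite mulrAC divff ?mul1r// gt_eqF.
Qed.

Lemma gauge_pos_infty Z : exists i s, [/\ lim_infty i, gauge Z s,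
  net_gt s (fun=> 0) & bigO i s].
Proof.
have [i Zi li] := gauge_infty Z; have [s [Zs s0 iis]] := gauge_add Zi Zi.
exists i, s; split => //; apply: bigO_trans iis.
apply: (bigO_le (for_smallT _)) => e _.
by rewrite [leRHS]ger0_norm ?addr_ge0// lerDl.
Qed.

Lemma negligible1 Z : ~ negligible Z (fun=> 1).
Proof.
have [i [s [li Zs s0 iis]]] := gauge_pos_infty Z.
move=> /(_ s Zs s0) h1; apply: (lim_infty_nbigO li).
apply: (bigO_trans iis); apply: (bigO_comb h1 h1 s0) => H1 H2 H10 _.
exists H1 => // e h _ s0e; move: h; rewrite normr1 mulr1 normfV.
by rewrite ler_pdivlMr ?mul1r// normr_gt0 gt_eqF.
Qed.

Lemma negligible_moderate B Z x : negligible Z x -> moderate B x.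
Proof.
have [i [s [li Zs s0 iis]]] := gauge_pos_infty Z.
move=> /(_ s Zs s0) h1; apply: (moderate_bigO h1).
apply: (moderate_bigO _ (moderate1 B)).
apply: (bigO_comb iis iis (lim_infty_gt 1 li)) => H1 H2 H10 _.
exists H1 => // e h _ i1; rewrite normr1 mulr1 normfV.
have h2 : 1 < H1 * `|s e| by exact: lt_le_trans h.
have sn : 0 < `|s e| by rewrite -(pmulr_rgt0 _ H10) (lt_trans _ h2).
by rewrite -[leLHS]mul1r ler_pdivrMr// ltW.
Qed.

End GaugeTheory.

Section GeneralizedNumbers.
Variables (R : realType) (I : index_set) (B : asymptotic_gauge R I).

Definition moderate_pred : {pred I -> R} := [pred x | `[< moderate B x >]].

Lemma moderate_predP x : reflect (moderate B x) (x \in moderate_pred).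
Proof. exact: asboolP. Qed.

Lemma moderate_subring : subring_closed moderate_pred.
Proof.
have N x : moderate B x -> moderate B (fun e => - x e).
  by apply: moderate_bigO; apply: (bigO_le (for_smallT _)) => e _; rewrite normrN.
split=> [|x y|x y]; first by apply/moderate_predP; exact: moderate1.
  move=> /moderate_predP hx /moderate_predP/N hy.
  by apply/moderate_predP; exact: moderateD hy.
move=> /moderate_predP hx /moderate_predP hy.
by apply/moderate_predP; exact: moderateM hy.
Qed.

HB.instance Definition _ :=
  GRing.isSubringClosed.Build (I -> R) moderate_pred moderate_subring.

Record mod_num := ModNum {
  mod_net :> I -> R;
  mod_netP : mod_net \in moderate_pred }.

HB.instance Definition _ := [isSub for mod_net].
HB.instance Definition _ := [Choice of mod_num by <:].
HB.instance Definition _ := 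
  GRing.SubChoice_isSubComPzRing.Build _ _ mod_num (subringClosedP _).

Lemma mod_num_oner_neq0 : 1 != 0 :> mod_num.
Proof.
have [e] := idx_inhabited I.
apply/eqP => h; have := congr1 (fun u : mod_num => u e) h.
by apply/eqP; exact: oner_neq0.
Qed.
HB.instance Definition _ :=
  GRing.PzSemiRing_isNonZero.Build mod_num mod_num_oner_neq0.

Variables (Z : asymptotic_gauge R I) (BZ : moderate B `<=` moderate Z).

(* The inclusion is an argument because it is what makes this set an ideal. *)
Definition neg_num of moderate B `<=` moderate Z : {pred mod_num} :=
  [pred x | `[< negligible Z (mod_net x) >]].

Lemma neg_numP (u : mod_num) : reflect (negligible Z u) (u \in neg_num BZ).
Proof. exact: asboolP. Qed.

Lemma neg_num_ideal : idealr_closed (neg_num BZ).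
Proof.
split; first by apply/neg_numP; exact: negligible0.
  by apply/neg_numP; exact: negligible1.
move=> a u v /neg_numP hu /neg_numP hv; apply/neg_numP.
apply: (negligibleD _ hv); apply: (negligibleM _ hu).
by apply: BZ; apply/moderate_predP; exact: mod_netP.
Qed.

HB.instance Definition _ := isIdealr.Build mod_num (neg_num BZ) neg_num_ideal.

Definition gen_num := {ideal_quot neg_num BZ}.
HB.instance Definition _ := GRing.ComNzRing.on gen_num.
HB.instance Definition _ := Quotient.on gen_num.

Lemma gen_numP (x y : mod_num) :
  reflect (negligible Z (fun e => x e - y e)) (x == y %[mod gen_num]).
Proof. by rewrite -Quotient.idealrBE; exact: (neg_numP (x - y)). Qed.

Definition gen_num_bounded (S : set (I -> R)) (x : gen_num) : Prop :=
  exists2 y : mod_num, moderate S y & \pi_gen_num y = x.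

Definition gen_mx_bounded (S : set (I -> R)) m n (M : 'M[gen_num]_(m, n)) : Prop :=
  forall i j, gen_num_bounded S (M i j).

End GeneralizedNumbers.

Section SmoothFunctions.
Variable R : realType.
Implicit Types (f g : R -> R) (K : set R) (n k : nat).

Definition smooth f : Prop := forall k x, derivable (derive1n k f) x 1.

(* [sup] of the empty set is 0, so K = set0 imposes no condition below. *)
Definition sup_on K f : R := sup [set `|f x| | x in K].

Definition smoothn n f : Prop :=
  forall k, (k <= n)%N -> forall x, derivable (derive1n k f) x 1.

Lemma smoothnS n f : smoothn n.+1 f <->
  (forall x, derivable f x 1) /\ smoothn n (derive1 f).
Proof.
split=> [h|[h0 h]].
  by split=> [x|k kn x]; [exact: (h 0) | rewrite -derive1Sn; exact: h].
by move=> [|k] kn x; [exact: h0 | rewrite derive1Sn; exact: h].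
Qed.

Lemma smoothE f : smooth f <-> forall n, smoothn n f.
Proof. by split=> h => [n k _|k]; [exact: h | exact: (h k)]. Qed.

Lemma smooth_derivable f x : smooth f -> derivable f x 1.
Proof. by move=> h; exact: (h 0). Qed.

Lemma smooth_derive1 f : smooth f -> smooth (derive1 f).
Proof. by move=> h k x; rewrite -derive1Sn; exact: h. Qed.

Lemma derive1_add f g : (forall x, derivable f x 1) ->
  (forall x, derivable g x 1) -> derive1 (f + g) = derive1 f + derive1 g.
Proof. by move=> hf hg; apply/funext => x; rewrite derive1E deriveD// -!derive1E. Qed.

Lemma derive1_sub f g : (forall x, derivable f x 1) ->
  (forall x, derivable g x 1) -> derive1 (f - g) = derive1 f - derive1 g.
Proof. by move=> hf hg; apply/funext => x; rewrite derive1E deriveB// -!derive1E. Qed.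

Lemma derive1_mul f g : (forall x, derivable f x 1) ->
  (forall x, derivable g x 1) -> derive1 (f * g) = derive1 f * g + f * derive1 g.
Proof.
move=> hf hg; apply/funext => x; rewrite derive1E deriveM// -!derive1E.
by rewrite addrC; congr (_ + _); rewrite [LHS]mulrC.
Qed.

Lemma smoothnD n f g : smoothn n f -> smoothn n g -> smoothn n (f + g).
Proof.
elim: n f g => [|n ih] f g.
  by move=> hf hg [|k] // _ x; exact: (derivableD (hf 0 isT x) (hg 0 isT x)).
move=> /smoothnS[f0 f1] /smoothnS[g0 g1]; apply/smoothnS; split.
  by move=> x; exact: derivableD.
by rewrite (derive1_add f0 g0); exact: (ih _ _ f1 g1).
Qed.

Lemma smoothD f g : smooth f -> smooth g -> smooth (f + g).
Proof.
by move=> /smoothE hf /smoothE hg; apply/smoothE => n; exact: smoothnD.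
Qed.

Lemma derive1nD k f g : smooth f -> smooth g ->
  derive1n k (f + g) = derive1n k f + derive1n k g.
Proof.
elim: k f g => [|k ih] f g hf hg; first by [].
rewrite !derive1Sn (derive1_add (hf 0) (hg 0)).
exact: (ih _ _ (smooth_derive1 hf) (smooth_derive1 hg)).
Qed.

Lemma smoothM f g : smooth f -> smooth g -> smooth (f * g).
Proof.
move=> hf hg; apply/smoothE => n; elim: n f g hf hg => [|n ih] f g hf hg.
  by move=> [|k] // _ x; exact: (derivableM (hf 0 x) (hg 0 x)).
apply/smoothnS; split => [x|].
  exact: (derivableM (hf 0 x) (hg 0 x)).
rewrite (derive1_mul (hf 0) (hg 0)).
apply: smoothnD; [exact: (ih _ _ (smooth_derive1 hf) hg)|].
exact: (ih _ _ hf (smooth_derive1 hg)).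
Qed.

Lemma derive1n_cst k (c : R) :
  derive1n k (cst c) = if k is 0 then cst c else cst 0.
Proof.
elim: k c => [//|k ih] c; rewrite derive1Sn.
have -> : derive1 (cst c) = cst (0 : R).
  by apply/funext => x; rewrite derive1_cst.
by rewrite ih; case: k {ih}.
Qed.

Lemma smooth_cst (c : R) : smooth (cst c).
Proof. by move=> k x; rewrite derive1n_cst; case: k => [|k]; exact: derivable_cst. Qed.

Lemma smooth_continuous f k : smooth f -> continuous (derive1n k f).
Proof.
by move=> h x; apply: differentiable_continuous; apply/derivable1_diffP; exact: h.
Qed.

Lemma sup_on_ub K f x : compact K -> continuous f -> K x -> `|f x| <= sup_on K f.
Proof.
move=> cK cf Kx; apply: ub_le_sup; last by exists x.
have /compact_bounded[M [Mr hM]] : compact (f @` K).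
  by apply: continuous_compact => //; exact: continuous_subspaceT.
exists (M + 1) => _ [y Ky <-]; apply: hM; first by rewrite ltrDl.
by exists y.
Qed.

Lemma sup_on_le K f (M : R) : 0 <= M -> (forall x, K x -> `|f x| <= M) ->
  sup_on K f <= M.
Proof.
move=> M0 h; have [->|/set0P[x Kx]] := eqVneq K set0.
  by rewrite /sup_on image_set0 sup0.
by apply: ge_sup => [|_ [y Ky <-]]; [exists `|f x|; exists x | exact: h].
Qed.

Lemma sup_on_ge0 K f : 0 <= sup_on K f.
Proof.
rewrite /sup_on; set E := [set _ | _ in _].
have [hE|nE] := pselect (has_sup E); last by rewrite sup_out.
have [[y [x Kx _]] ubE] := hE.
by apply: (le_trans (normr_ge0 (f x))); apply: ub_le_sup => //; exists x.
Qed.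

End SmoothFunctions.

Section ModerateFunctions.
Variables (R : realType) (I : index_set).
Implicit Types (S : set (I -> R)) (u v : I -> R -> R).

(* The domain is the whole real line, so multi-indices are natural numbers. *)
Definition moderate_fun S : set (I -> R -> R) :=
  [set u | (forall e, smooth (u e)) /\
    forall K, compact K -> forall k,
      moderate S (fun e => sup_on K (derive1n k (u e)))].

Definition negligible_fun S : set (I -> R -> R) :=
  [set u | (forall e, smooth (u e)) /\
    forall K, compact K -> forall k,
      negligible S (fun e => sup_on K (derive1n k (u e)))].

Lemma sup_onD_bigO K u v : compact K ->
  (forall e, continuous (u e)) -> (forall e, continuous (v e)) ->
  bigO (fun e => sup_on K (u e + v e))
       (fun e => sup_on K (u e) + sup_on K (v e)).
Proof.
move=> cK cu cv; apply: (bigO_le (for_smallT _)) => e _.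
rewrite !ger0_norm ?addr_ge0 ?sup_on_ge0//.
apply: sup_on_le => [|x Kx]; first by rewrite addr_ge0 ?sup_on_ge0.
by rewrite (le_trans (ler_normD _ _))// lerD//; exact: sup_on_ub.
Qed.

Lemma sup_onM_bigO K u v : compact K ->
  (forall e, continuous (u e)) -> (forall e, continuous (v e)) ->
  bigO (fun e => sup_on K (u e * v e))
       (fun e => sup_on K (u e) * sup_on K (v e)).
Proof.
move=> cK cu cv; apply: (bigO_le (for_smallT _)) => e _.
rewrite !ger0_norm ?mulr_ge0 ?sup_on_ge0//.
apply: sup_on_le => [|x Kx]; first by rewrite mulr_ge0 ?sup_on_ge0.
by rewrite normrM ler_pM//; exact: sup_on_ub.
Qed.

Section Product.
Variables (P Q : set (I -> R)).
Hypothesis PO : forall x y : I -> R, bigO x y -> Q y -> Q x.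
Hypothesis PD : forall x y : I -> R, Q x -> Q y -> Q (fun e => x e + y e).
Hypothesis PM : forall x y : I -> R, P x -> Q y -> Q (fun e => x e * y e).

Let fun_in (S : set (I -> R)) u := forall K, compact K -> forall k,
  S (fun e => sup_on K (derive1n k (u e))).

Lemma fun_inD u v : (forall e, smooth (u e)) -> (forall e, smooth (v e)) ->
  fun_in Q u -> fun_in Q v -> fun_in Q (u + v).
Proof.
move=> su sv hu hv K cK k.
under eq_fun => e do rewrite [(u + v) e]/(u e + v e) derive1nD//.
apply: PO (PD (hu K cK k) (hv K cK k)).
by apply: sup_onD_bigO => // e; exact: smooth_continuous.
Qed.

Lemma fun_inM u v : (forall e, smooth (u e)) -> (forall e, smooth (v e)) ->
  fun_in P u -> fun_in Q v -> fun_in Q (u * v).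
Proof.
move=> su sv hu hv K cK k.
elim: k u v su sv hu hv => [|k ih] u v su sv hu hv.
  apply: PO (PM (hu K cK 0) (hv K cK 0)).
  by apply: sup_onM_bigO => // e; exact: (smooth_continuous (k := 0)).
have hd (S : set (I -> R)) w : fun_in S w -> fun_in S (fun e => derive1 (w e)).
  by move=> hw K' cK' j; under eq_fun => e do rewrite -derive1Sn; exact: hw.
pose du e := derive1 (u e); pose dv e := derive1 (v e).
have sdu e : smooth (du e) by exact: smooth_derive1.
have sdv e : smooth (dv e) by exact: smooth_derive1.
have -> : (fun e => sup_on K (derive1n k.+1 ((u * v) e))) =
          (fun e => sup_on K (derive1n k ((du * v) e) + derive1n k ((u * dv) e))).
  apply/funext => e.
  have E : derive1n k.+1 (u e * v e) =
           derive1n k (du e * v e) + derive1n k (u e * dv e).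
    rewrite derive1Sn (derive1_mul (su e 0) (sv e 0)).
    exact: (derive1nD k (smoothM (sdu e) (sv e)) (smoothM (su e) (sdv e))).
  exact: (congr1 (sup_on K) E).
have h1 := ih _ _ sdu sv (hd _ _ hu) hv.
have h2 := ih _ _ su sdv hu (hd _ _ hv).
apply: PO (PD h1 h2).
by apply: sup_onD_bigO => // e; apply: smooth_continuous; exact: smoothM.
Qed.

End Product.

Lemma sup_on_cst_bigO K k (x : I -> R) :
  bigO (fun e => sup_on K (derive1n k (cst (x e)))) x.
Proof.
apply: (bigO_le (for_smallT _)) => e _; rewrite ger0_norm ?sup_on_ge0//.
apply: sup_on_le => // t _; rewrite derive1n_cst.
by case: k => [|k] //=; rewrite normr0.
Qed.

Lemma moderate_fun_cst S x : moderate S x -> moderate_fun S (fun e => cst (x e)).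
Proof.
move=> hx; split=> [e|K cK k]; first exact: smooth_cst.
exact: moderate_bigO (sup_on_cst_bigO K k x) hx.
Qed.

Lemma negligible_fun_cst S x :
  negligible S x -> negligible_fun S (fun e => cst (x e)).
Proof.
move=> hx; split=> [e|K cK k]; first exact: smooth_cst.
exact: negligible_bigO (sup_on_cst_bigO K k x) hx.
Qed.

Lemma moderate_fun_derive1 S u : moderate_fun S u ->
  moderate_fun S (fun e => derive1 (u e)).
Proof.
move=> [su hu]; split=> [e|K cK k]; first exact: smooth_derive1.
by under eq_fun => e do rewrite -derive1Sn; exact: hu.
Qed.

Lemma negligible_fun_derive1 S u : negligible_fun S u ->
  negligible_fun S (fun e => derive1 (u e)).
Proof.
move=> [su hu]; split=> [e|K cK k]; first exact: smooth_derive1.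
by under eq_fun => e do rewrite -derive1Sn; exact: hu.
Qed.

Lemma eval_bigO (t : R) u : (forall e, smooth (u e)) ->
  bigO (fun e => u e t) (fun e => sup_on [set t] (derive1n 0 (u e))).
Proof.
move=> su; apply: (bigO_le (for_smallT _)) => e _.
rewrite [leRHS]ger0_norm ?sup_on_ge0//.
apply: (@sup_on_ub R [set t] (u e)) => //; first exact: compact_set1.
exact: (smooth_continuous (k := 0)).
Qed.

Lemma moderate_fun_eval S u t : moderate_fun S u -> moderate S (fun e => u e t).
Proof.
by move=> [su hu]; apply: moderate_bigO (eval_bigO t su) _;
  apply: hu; exact: compact_set1.
Qed.

Lemma negligible_fun_eval S u t :
  negligible_fun S u -> negligible S (fun e => u e t).
Proof.
by move=> [su hu]; apply: negligible_bigO (eval_bigO t su) _;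
  apply: hu; exact: compact_set1.
Qed.

Implicit Types (B Z : asymptotic_gauge R I).

Lemma moderate_funD B u v :
  moderate_fun B u -> moderate_fun B v -> moderate_fun B (u + v).
Proof.
move=> [su hu] [sv hv]; split=> [e|]; first exact: smoothD.
apply: fun_inD => //; [exact: moderate_bigO|exact: moderateD].
Qed.

Lemma moderate_funM B u v :
  moderate_fun B u -> moderate_fun B v -> moderate_fun B (u * v).
Proof.
move=> [su hu] [sv hv]; split=> [e|]; first exact: smoothM.
by apply: (@fun_inM (moderate B)) => //;
  [exact: moderate_bigO|exact: moderateD|exact: moderateM].
Qed.

Lemma negligible_funD S u v :
  negligible_fun S u -> negligible_fun S v -> negligible_fun S (u + v).
Proof.
move=> [su hu] [sv hv]; split=> [e|]; first exact: smoothD.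
apply: fun_inD => //; [exact: negligible_bigO|exact: negligibleD].
Qed.

Lemma negligible_funM B Z u v : moderate B `<=` moderate Z ->
  moderate_fun B u -> negligible_fun Z v -> negligible_fun Z (u * v).
Proof.
move=> BZ [su hu] [sv hv]; split=> [e|]; first exact: smoothM.
apply: (@fun_inM (moderate Z)) => //; [exact: negligible_bigO|
  exact: negligibleD|exact: negligibleM|by move=> K cK k; apply: BZ; exact: hu].
Qed.

Lemma negligible_fun_moderate B Z : negligible_fun Z `<=` moderate_fun B.
Proof.
by move=> u [su hu]; split=> // K cK k; exact: negligible_moderate (hu K cK k).
Qed.

End ModerateFunctions.

Section GeneralizedFunctions.
Variables (R : realType) (I : index_set) (B : asymptotic_gauge R I).

Definition moderate_fun_pred : {pred I -> R -> R} :=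
  [pred u | `[< moderate_fun B u >]].

Lemma moderate_fun_predP u :
  reflect (moderate_fun B u) (u \in moderate_fun_pred).
Proof. exact: asboolP. Qed.

Lemma moderate_fun_subring : subring_closed moderate_fun_pred.
Proof.
have C1 : moderate_fun B 1 by exact: (moderate_fun_cst (moderate1 B)).
have CN : moderate_fun B (fun=> cst (-1)).
  apply: (@moderate_fun_cst _ _ B (fun=> -1)).
  apply: moderate_bigO (moderate1 B); apply: (bigO_le (for_smallT _)) => e _.
  by rewrite normrN.
split=> [|u v|u v]; first by apply/moderate_fun_predP.
  move=> /moderate_fun_predP hu /moderate_fun_predP hv.
  apply/moderate_fun_predP; apply: moderate_funD => //.
  have -> : - v = (fun=> cst (-1)) * v.
    by apply/funext => e; apply/funext => t; rewrite [RHS]mulN1r.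
  exact: moderate_funM.
move=> /moderate_fun_predP hu /moderate_fun_predP hv.
by apply/moderate_fun_predP; exact: moderate_funM.
Qed.

HB.instance Definition _ :=
  GRing.isSubringClosed.Build (I -> R -> R) moderate_fun_pred
    moderate_fun_subring.

Record mod_fun := ModFun {
  mod_fun_net :> I -> R -> R;
  mod_fun_netP : mod_fun_net \in moderate_fun_pred }.

HB.instance Definition _ := [isSub for mod_fun_net].
HB.instance Definition _ := [Choice of mod_fun by <:].
HB.instance Definition _ :=
  GRing.SubChoice_isSubComPzRing.Build _ _ mod_fun (subringClosedP _).

Lemma mod_fun_oner_neq0 : 1 != 0 :> mod_fun.
Proof.
have [e] := idx_inhabited I.
apply/eqP => h; have := congr1 (fun u : mod_fun => u e 0) h.
by apply/eqP; exact: oner_neq0.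
Qed.
HB.instance Definition _ :=
  GRing.PzSemiRing_isNonZero.Build mod_fun mod_fun_oner_neq0.

Definition mod_fun_cst (x : mod_num B) : mod_fun :=
  ModFun (introT (moderate_fun_predP _)
    (moderate_fun_cst (elimT (moderate_predP _ _) (mod_netP x)))).

Definition mod_fun_derive (u : mod_fun) : mod_fun :=
  ModFun (introT (moderate_fun_predP _)
    (moderate_fun_derive1 (elimT (moderate_fun_predP _) (mod_fun_netP u)))).

Definition mod_fun_eval (t : R) (u : mod_fun) : mod_num B :=
  ModNum (introT (moderate_predP _ _)
    (moderate_fun_eval t (elimT (moderate_fun_predP _) (mod_fun_netP u)))).

Variables (Z : asymptotic_gauge R I) (BZ : moderate B `<=` moderate Z).

(* By negligible_fun_moderate this is all of [negligible_fun Z]. *)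
Definition neg_fun of moderate B `<=` moderate Z : {pred mod_fun} :=
  [pred u | `[< negligible_fun Z (mod_fun_net u) >]].

Lemma neg_funP (u : mod_fun) : reflect (negligible_fun Z u) (u \in neg_fun BZ).
Proof. exact: asboolP. Qed.

Lemma neg_fun_ideal : idealr_closed (neg_fun BZ).
Proof.
split.
- by apply/neg_funP; exact: (negligible_fun_cst (@negligible0 _ _ Z)).
- apply/neg_funP => /(negligible_fun_eval 0) h; exact: (@negligible1 _ _ Z h).
move=> a u v /neg_funP hu /neg_funP hv; apply/neg_funP.
have /moderate_fun_predP ha := mod_fun_netP a.
exact: (negligible_funD (negligible_funM BZ ha hu) hv).
Qed.

HB.instance Definition _ := isIdealr.Build mod_fun (neg_fun BZ) neg_fun_ideal.

Definition gen_fun := {ideal_quot neg_fun BZ}.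
HB.instance Definition _ := GRing.ComNzRing.on gen_fun.
HB.instance Definition _ := Quotient.on gen_fun.

Lemma gen_funP (u v : mod_fun) :
  reflect (negligible_fun Z (fun e => u e - v e)) (u == v %[mod gen_fun]).
Proof. by rewrite -Quotient.idealrBE; exact: (neg_funP (u - v)). Qed.

(* The embedding of generalized numbers as constant generalized functions. *)
Definition gen_cst (x : gen_num BZ) : gen_fun :=
  \pi_gen_fun (mod_fun_cst (repr x)).

Definition gen_derive (u : gen_fun) : gen_fun :=
  \pi_gen_fun (mod_fun_derive (repr u)).

Definition gen_eval (t : R) (u : gen_fun) : gen_num BZ :=
  \pi_(gen_num BZ) (mod_fun_eval t (repr u)).

(* The three maps do not depend on the representative. *)
Lemma gen_cstE x : gen_cst (\pi_(gen_num BZ) x) = \pi_gen_fun (mod_fun_cst x).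
Proof.
apply/eqP/gen_funP; have /eqP/gen_numP h := reprK (\pi_(gen_num BZ) x).
exact: (negligible_fun_cst h).
Qed.

Lemma gen_deriveE u :
  gen_derive (\pi_gen_fun u) = \pi_gen_fun (mod_fun_derive u).
Proof.
apply/eqP/gen_funP; have /eqP/gen_funP h := reprK (\pi_gen_fun u).
have := negligible_fun_derive1 h; congr (negligible_fun Z _).
have /moderate_fun_predP[sr _] := mod_fun_netP (repr (\pi_gen_fun u)).
have /moderate_fun_predP[su _] := mod_fun_netP u.
by apply/funext => e; exact: (derive1_sub (sr e 0) (su e 0)).
Qed.

Lemma gen_evalE t u :
  gen_eval t (\pi_gen_fun u) = \pi_(gen_num BZ) (mod_fun_eval t u).
Proof.
apply/eqP/gen_numP; have /eqP/gen_funP h := reprK (\pi_gen_fun u).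
exact: (negligible_fun_eval t h).
Qed.

End GeneralizedFunctions.

(* Main.v *)
From Pilot Require Import Defs.
From HB Require Import structures.
From mathcomp Require Import all_boot all_order all_algebra.
From mathcomp Require Import all_classical all_reals all_analysis.

Set Implicit Arguments.
Unset Strict Implicit.
Unset Printing Implicit Defensive.

Import Order.TTheory GRing.Theory Num.Theory.
Import numFieldNormedType.Exports.
(* From here on bigO is the relation on nets, not the Landau notation. *)
Import Pilot.Defs.

Local Open Scope classical_set_scope.
Local Open Scope ring_scope.
Local Open Scope quotient_scope.

(** The proof is the classical one by a fundamental matrix, carried out inside
    the differential ring of generalized functions.

    A generalized function is determined by its derivative and its value at t0
    ([gen_fun_derive_inj]). By the mean value theorem, the sup of a function on
    a compact set is at most its value at t0 plus a constant times the sup of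
    its derivative on a larger segment, so a net is negligible as soon as its
    derivative and its value at t0 are ([negligible_fun_primitive]).

    A matrix A bounded by B has an exponential ([gen_mx_exp_exists]): a matrix
    E of generalized functions with E' = E A and E(t0) = 1. Its entries are the
    power series of exp((t - t0) A_e), and all their derivatives at t are
    bounded by N^k exp(N |t - t0|), where N is the sum of the absolute values
    of the entries of A_e. Such bounds are moderate for B' because exp maps
    nets moderate for B to nets moderate for the exponential gauge. This is not
    immediate, since the constants of big-O depend on the index a and would
    land in the exponent: they are first absorbed by a net of the gauge that
    tends to infinity ([moderate_dominated]).

    The exponential of - A^T, transposed, gives F with F' = - A F and
    F(t0) = 1. Then (E F)' = E A F - E A F = 0 and (E F)(t0) = 1, so E F = 1 and
    also F E = 1. Hence F c is a solution. Conversely, if x is a solution then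
    (E x)' = E A x + E x' = 0, so E x is the constant c and x = F c. *)

(** * Exponential generating functions *)

Section ExponentialGeneratingFunctions.
Variable R : realType.
Implicit Types (a : nat -> R) (C N t : R).

Definition geometrically_bounded a C N := forall n, `|a n| <= C * N ^+ n.

(** With a n = (M ^+ n) i j this is the (i, j) entry of exp(tM); working with
    general coefficients makes all derivatives instances of the same object,
    because differentiation shifts the sequence. *)
Definition egf a t : R := limn (pseries (fun n => a n / n`!%:R) t).

Lemma egf_term_le a C N t n : geometrically_bounded a C N ->
  `|a n / n`!%:R * t ^+ n| <= C * exp_coeff (N * `|t|) n.
Proof.
move=> aCN; rewrite /exp_coeff /= !normrM normfV normrX normr_nat exprMn.
have -> : C * (N ^+ n * `|t| ^+ n / n`!%:R) = C * N ^+ n / n`!%:R * `|t| ^+ n.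
  by rewrite mulrAC !mulrA.
by rewrite ler_wpM2r// ler_wpM2r.
Qed.

Lemma is_cvg_egf_major C N t : cvgn (series (fun n => C * exp_coeff (N * `|t|) n)).
Proof.
apply: (@is_cvg_seriesZ _ (exp_coeff (N * `|t|)) C).
exact: is_cvg_series_exp_coeff.
Qed.

Lemma is_cvg_egf_norm a C N t : geometrically_bounded a C N ->
  cvgn [normed series (fun n => a n / n`!%:R * t ^+ n)].
Proof.
move=> aCN; apply: (@series_le_cvg _ _ (fun n => C * exp_coeff (N * `|t|) n)).
- by move=> n; exact: normr_ge0.
- by move=> n; exact: le_trans (egf_term_le t n aCN).
- by move=> n; exact: egf_term_le.
exact: is_cvg_egf_major.
Qed.

Lemma is_cvg_egf a C N t : geometrically_bounded a C N ->
  cvgn (pseries (fun n => a n / n`!%:R) t).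
Proof. by move=> aCN; apply: normed_cvg; exact: is_cvg_egf_norm aCN. Qed.

Lemma egf_le a C N t : geometrically_bounded a C N ->
  `|egf a t| <= C * expR (N * `|t|).
Proof.
move=> aCN; have cn := is_cvg_egf_norm (t := t) aCN.
apply: (le_trans (lim_series_norm cn)).
have -> : C * expR (N * `|t|) = limn (series (fun n => C * exp_coeff (N * `|t|) n)).
  apply/esym/(@lim_seriesZ _ (exp_coeff (N * `|t|)) C).
  exact: is_cvg_series_exp_coeff.
apply: lim_series_le => //; first exact: is_cvg_egf_major.
by move=> n; exact: egf_term_le.
Qed.

Lemma geometrically_bounded_shift a C N k : geometrically_bounded a C N ->
  geometrically_bounded (fun n => a (n + k)%N) (C * N ^+ k) N.
Proof. by move=> aCN n; rewrite -mulrA -exprD addnC; exact: aCN. Qed.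

Lemma pseries_diffs_egf a :
  pseries_diffs (fun n => a n / n`!%:R) = (fun n => a n.+1 / n`!%:R).
Proof.
apply/funext => n; rewrite /pseries_diffs factS natrM invfM.
by rewrite mulrCA mulVKf.
Qed.

(** Termwise differentiation needs the convergence of the twice differentiated
    series beyond t; shifted sequences are again geometrically bounded, so this
    holds at every radius. *)
Lemma is_derive_egf a C N t : geometrically_bounded a C N ->
  is_derive t 1 (egf a) (egf (fun n => a n.+1) t).
Proof.
move=> aCN.
have a1 : geometrically_bounded (fun n => a n.+1) (C * N) N.
  by move=> n; have := geometrically_bounded_shift 1 aCN n; rewrite addn1 expr1.
have a2 : geometrically_bounded (fun n => a n.+2) (C * N * N) N.
  by move=> n; have := geometrically_bounded_shift 1 a1 n; rewrite addn1 expr1.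
rewrite /egf -pseries_diffs_egf.
apply: (@pseries_snd_diffs _ _ (`|t| + 1)).
- exact: is_cvg_egf aCN.
- by rewrite pseries_diffs_egf; exact: is_cvg_egf a1.
- by rewrite !pseries_diffs_egf; exact: is_cvg_egf a2.
by rewrite [ltRHS]ger0_norm ?ltrDl ?addr_ge0.
Qed.

Lemma is_derive_egf_shift a C N t0 t : geometrically_bounded a C N ->
  is_derive t 1 (fun t => egf a (t - t0)) (egf (fun n => a n.+1) (t - t0)).
Proof.
move=> /(is_derive_egf (t - t0)) da.
rewrite -[X in is_derive _ _ _ X]mulr1.
by have := @is_derive1_comp _ _ (shift (- t0)) t _ _ da (is_derive_shift t 1 _).
Qed.

Lemma derive1n_egf a C N t0 k : geometrically_bounded a C N ->
  derive1n k (fun t => egf a (t - t0)) =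
  (fun t => egf (fun n => a (n + k)%N) (t - t0)).
Proof.
move=> aCN; elim: k => [|k ih].
  by apply/funext => t /=; congr (egf _ _); apply/funext => n; rewrite addn0.
rewrite derive1nS ih; apply/funext => t; rewrite derive1E.
have -> : (fun n => a (n + k.+1)%N) = (fun n => a (n.+1 + k)%N).
  by apply/funext => n; rewrite addnS addSn.
apply: (@derive_val _ _ _ _ _ _ _ (is_derive_egf_shift _ _ _)).
exact: geometrically_bounded_shift aCN.
Qed.

Lemma smooth_egf a C N t0 : geometrically_bounded a C N ->
  smooth (fun t => egf a (t - t0)).
Proof.
move=> aCN k t; rewrite (derive1n_egf _ _ aCN).
have := is_derive_egf_shift t0 t (geometrically_bounded_shift k aCN).
exact: @ex_derive.
Qed.

Lemma egf0 a : egf a 0 = a 0.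
Proof.
apply: lim_near_cst => //; near=> n.
rewrite /pseries /series /= -[n]prednK; last by near: n; exact: nbhs_infty_gt.
rewrite big_nat_recl// fact0 divr1 expr0 mulr1 big1 ?addr0// => i _.
by rewrite expr0n mulr0.
Unshelve. all: by end_near. Qed.

Lemma egf_sum (J : finType) (a : J -> nat -> R) (y : J -> R) C N t :
  (forall j, geometrically_bounded (a j) C N) ->
  egf (fun n => \sum_j a j n * y j) t = \sum_j egf (a j) t * y j.
Proof.
move=> aCN; apply: cvg_lim => //.
have -> : pseries (fun n => (\sum_j a j n * y j) / n`!%:R) t =
    (fun n => \sum_j pseries (fun n => a j n / n`!%:R) t n * y j).
  apply/funext => n; rewrite /pseries /series /=.
  under [RHS]eq_bigr do rewrite mulr_suml.
  rewrite exchange_big /=; apply: eq_bigr => i _.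
  rewrite !mulr_suml; apply: eq_bigr => j _.
  by rewrite -!mulrA; congr (_ * _); rewrite mulrC mulrA.
apply: cvg_big => [|j _]; first exact: add_continuous.
by apply: cvgMr_tmp; exact: is_cvg_egf (aCN j).
Qed.

End ExponentialGeneratingFunctions.

(** * Powers of a matrix *)

Section MatrixPowers.
Variables (R : realType) (d : nat).
Implicit Types M : 'M[R]_d.

(** This norm is submultiplicative, dominates every entry, and is moderate along
    a net of matrices as soon as the entries are. *)
Definition mx_norm1 M : R := \sum_i \sum_j `|M i j|.

Lemma mx_norm1_ge0 M : 0 <= mx_norm1 M.
Proof. by apply: sumr_ge0 => i _; exact: sumr_ge0. Qed.

Lemma row_norm1_le M i : \sum_j `|M i j| <= mx_norm1 M.
Proof.
rewrite [leRHS](bigD1 i)//= lerDl.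
by apply: sumr_ge0 => k _; exact: sumr_ge0.
Qed.

Lemma mx_exp_bounded M i j :
  geometrically_bounded (fun n => (M ^+ n) i j) 1 (mx_norm1 M).
Proof.
move=> n; rewrite mul1r; elim: n i j => [|n ih] i j.
  by rewrite !expr0 mxE; case: eqVneq => _; rewrite ?normr1 ?normr0.
rewrite !exprS mxE (le_trans (ler_norm_sum _ _ _))//.
apply: (@le_trans _ _ (\sum_k `|M i k| * mx_norm1 M ^+ n)).
  by apply: ler_sum => k _; rewrite normrM ler_wpM2l.
by rewrite -mulr_suml ler_wpM2r ?row_norm1_le// exprn_ge0// mx_norm1_ge0.
Qed.

End MatrixPowers.

(** * Moderate nets and exponentials *)

Lemma compact_dist_le (R : realType) (K : set R) (t0 : R) : compact K ->
  exists2 T, 0 <= T & forall t, K t -> `|t - t0| <= T.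
Proof.
move=> /compact_bounded[M [Mr hM]]; exists (`|M| + 1 + `|t0|).
  by rewrite !addr_ge0.
move=> t Kt; rewrite (le_trans (ler_normB _ _))// lerD2r.
by apply: hM => //; rewrite (le_lt_trans (ler_norm M))// ltrDl.
Qed.

Section ModerateNets.
Variables (R : realType) (I : index_set).
Implicit Types (B : asymptotic_gauge R I) (x : I -> R).

Lemma moderate_le B x y : (forall e, `|x e| <= `|y e|) ->
  moderate B y -> moderate B x.
Proof.
by move=> xy; apply: moderate_bigO; apply: (bigO_le (for_smallT _)) => e _.
Qed.

Lemma moderate_cst B (r : R) : moderate B (fun=> r).
Proof.
apply: (moderate_bigO _ (moderate1 B)).
have one := bigO_refl (fun _ : I => 1 : R).
apply: (bigO_comb one one (for_smallT I)) => H1 H2 _ _.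
exists (`|r| + 1) => [|e _ _ _]; first by rewrite ltr_wpDl.
by rewrite normr1 mulr1 lerDl.
Qed.

Lemma moderateX B x k : moderate B x -> moderate B (fun e => x e ^+ k).
Proof.
move=> Bx; elim: k => [|k ih]; first by under eq_fun do rewrite expr0; exact: moderate1.
by under eq_fun do rewrite exprS; exact: moderateM.
Qed.

Lemma moderate_sum B (J : finType) (x : J -> I -> R) :
  (forall j, moderate B (x j)) -> moderate B (fun e => \sum_j x j e).
Proof.
move=> Bx; have -> : (fun e => \sum_j x j e) = \sum_j x j.
  by apply/funext => e; rewrite fct_sumE.
by apply: big_ind => [|y z|j _] //; [exact: moderate_cst|exact: moderateD].
Qed.

(** The constant of a big-O may depend on the index a. Multiplying x by a net i
    of the gauge that tends to infinity and bounding the product |x i| <= H s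
    leaves |x| <= s as soon as |i| > H, whatever H is. *)
Lemma moderate_dominated B x : moderate B x ->
  exists2 s, gauge B s & for_small (fun e => `|x e| <= s e).
Proof.
move=> Bx; have [i Bi li] := gauge_infty B.
have [p Bp xip] := moderateM Bx (ex_intro2 _ _ i Bi (bigO_refl i)).
have [s [Bs s0 pps]] := gauge_add Bp Bp; exists s => //.
have [A1 fA1 h1] : bigO (fun e => x e * i e) s.
  apply: (bigO_trans xip); apply: bigO_trans pps; apply: (bigO_le (for_smallT _)) => e _.
  by rewrite [leRHS]ger0_norm ?addr_ge0// lerDl.
have [A2 fA2 h2] := li; have [A3 fA3 h3] := s0.
have [C' fC' sC'] := idx_famI fA1 fA2.
have [C fC sC] := idx_famI fC' fA3.
have s1 : C `<=` A1 by move=> t /sC[/sC'[]].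
have s2 : C `<=` A2 by move=> t /sC[/sC'[]].
have s3 : C `<=` A3 by move=> t /sC[].
exists C => // a Ca.
have [H [H0 /(ev_at_sub fC s1 Ca) e1]] := h1 _ (s1 _ Ca).
have [b2 ab2 /(ev_at_of_le fA2 (s2 _ Ca) ab2)/(ev_at_sub fC s2 Ca) e2] :=
  h2 _ (s2 _ Ca) _ H0.
have [b3 ab3 /(ev_at_of_le fA3 (s3 _ Ca) ab3)/(ev_at_sub fC s3 Ca) e3] :=
  h3 _ (s3 _ Ca).
have [e0 [e0a _] he0] := ev_at_and fC Ca (ev_at_and fC Ca e1 e2) e3.
exists e0 => // e /he0[[xs Hi] se]; have i0 := lt_trans H0 Hi.
rewrite -(ler_pM2r i0) -normrM (le_trans xs)// (gtr0_norm se) mulrC.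
by rewrite ler_pM2l// ltW.
Qed.

(** A bound with a constant H_a depending on a would give exp(H_a s_e), which is
    not controlled by the exponential gauge; hence the use of
    [moderate_dominated]. *)
Lemma moderate_expR B B' x : moderate (exp_gauge B) `<=` moderate B' ->
  moderate B x -> moderate B' (fun e => expR (x e)).
Proof.
move=> BB' /moderate_dominated[s Bs xs]; apply: BB'.
exists (fun e => expR (1 * s e)); first by exists 1, s.
apply: (bigO_le xs) => e xse; rewrite !ger0_norm ?expR_ge0// ler_expR mul1r.
exact: le_trans (ler_norm _) xse.
Qed.

(** The k-th derivative is again an exponential generating function, of the
    shifted coefficients, so it is at most N^k exp(N T) at distance T from t0.
    A bound on N itself comes for free from N <= exp N. *)
Lemma moderate_fun_egf B (a : I -> nat -> R) (N : I -> R) (t0 : R) :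
  (forall e, 0 <= N e) -> (forall e, geometrically_bounded (a e) 1 (N e)) ->
  (forall T, 0 <= T -> moderate B (fun e => expR (N e * T))) ->
  moderate_fun B (fun e t => egf (a e) (t - t0)).
Proof.
move=> N0 aN BN; split=> [e|K cK k]; first exact: smooth_egf (aN e).
have [T T0 KT] := compact_dist_le t0 cK.
have mN : moderate B N.
  apply: moderate_le (BN 1 ler01) => e; rewrite mulr1.
  rewrite !ger0_norm ?expR_ge0//; apply: le_trans (expR_ge1Dx _).
  by rewrite lerDr.
apply: moderate_le (moderateM (moderateX k mN) (BN T T0)) => e.
have M0 : 0 <= N e ^+ k * expR (N e * T) by rewrite mulr_ge0 ?expR_ge0 ?exprn_ge0.
rewrite (ger0_norm M0) ger0_norm ?sup_on_ge0//; apply: sup_on_le => // t Kt.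
rewrite (derive1n_egf _ _ (aN e)).
apply: (le_trans (egf_le _ (geometrically_bounded_shift k (aN e)))).
by rewrite mul1r ler_wpM2l ?exprn_ge0// ler_expR ler_wpM2l// KT.
Qed.

End ModerateNets.

(** * Negligibility of primitives *)

Section Primitives.
Variables (R : realType) (I : index_set).

Lemma mean_value_le (f : R -> R) (t0 t T : R) : smooth f -> `|t - t0| <= T ->
  `|f t| <= `|f t0| + sup_on `[t0 - T, t0 + T] (derive1 f) * T.
Proof.
move=> sf tT; set S := sup_on _ _.
have mv a b : a <= b -> exists2 c, c \in `[a, b] & f b - f a = derive1 f c * (b - a).
  move=> ab; apply: MVT_segment => // [x _|].
    by rewrite derive1E; apply: derivableP; exact: smooth_derivable.
  by apply: continuous_subspaceT; exact: (smooth_continuous (k := 0)).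
have bS c : c \in `[t0 - T, t0 + T] -> `|derive1 f c| <= S.
  move=> cT; apply: sup_on_ub => //; first exact: segment_compact.
  exact: (smooth_continuous (k := 1)).
have T0 : 0 <= T := le_trans (normr_ge0 _) tT.
rewrite -lerBlDl (le_trans (lerB_dist _ _))//.
move: (tT); rewrite ler_distl => /andP[tl tr].
have [t0t|/ltW tt0] := leP t0 t.
  have [c] := mv _ _ t0t; rewrite in_itv/= => /andP[c1 c2] ->.
  rewrite normrM ler_pM// bS// in_itv/= (le_trans _ c1) ?(le_trans c2)//.
  by rewrite gerBl.
rewrite distrC; have [c] := mv _ _ tt0; rewrite in_itv/= => /andP[c1 c2] ->.
rewrite normrM ler_pM ?(distrC t0)// bS// in_itv/= (le_trans _ c1)//=.
by rewrite (le_trans c2)// lerDl.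
Qed.

Lemma negligible_fun_primitive (Z : asymptotic_gauge R I) (u : I -> R -> R) t0 :
  (forall e, smooth (u e)) -> negligible_fun Z (fun e => derive1 (u e)) ->
  negligible Z (fun e => u e t0) -> negligible_fun Z u.
Proof.
move=> su [_ du] u0; split => // K cK [|k]; last first.
  by under eq_fun do rewrite derive1Sn; exact: du.
have [T T0 KT] := compact_dist_le t0 cK.
have h := negligibleM (moderate_cst Z T) (du _ (@segment_compact R (t0 - T) (t0 + T)) 0%N).
have nu0 : negligible Z (fun e => `|u e t0|).
  by apply: negligible_bigO u0; apply: (bigO_le (for_smallT _)) => e _; rewrite normr_id.
apply: negligible_bigO (negligibleD nu0 h).
apply: (bigO_le (for_smallT _)) => e _; rewrite ger0_norm ?sup_on_ge0//.
rewrite [leRHS]ger0_norm ?addr_ge0 ?mulr_ge0 ?sup_on_ge0//.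
apply: sup_on_le => [|t Kt]; first by rewrite addr_ge0 ?mulr_ge0 ?sup_on_ge0.
by rewrite mulrC; exact: (mean_value_le (su e) (KT t Kt)).
Qed.

End Primitives.

(** * Calculus in the ring of generalized functions *)

Section GeneralizedCalculus.
Variables (R : realType) (I : index_set) (B Z : asymptotic_gauge R I).
Variable BZ : moderate B `<=` moderate Z.
Local Notation G := (gen_fun BZ).
Local Notation K := (gen_num BZ).
Local Notation deriv := (@gen_derive _ _ _ _ BZ).
Local Notation eval := (@gen_eval _ _ _ _ BZ).
Local Notation gcst := (@gen_cst _ _ _ _ BZ).
Implicit Types (u v : G) (U V : mod_fun B) (t : R).

Lemma pi_funD U V : \pi_G (U + V) = \pi_G U + \pi_G V.
Proof. exact: (rmorphD \pi_(Quotient.quot (neg_fun BZ))). Qed.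

Lemma pi_funB U V : \pi_G (U - V) = \pi_G U - \pi_G V.
Proof. exact: (rmorphB \pi_(Quotient.quot (neg_fun BZ))). Qed.

Lemma pi_fun_sum (J : finType) (U_ : J -> mod_fun B) :
  \pi_G (\sum_j U_ j) = \sum_j \pi_G (U_ j).
Proof. exact: (rmorph_sum \pi_(Quotient.quot (neg_fun BZ))). Qed.

Lemma pi_funM U V : \pi_G (U * V) = \pi_G U * \pi_G V.
Proof. exact: (rmorphM \pi_(Quotient.quot (neg_fun BZ))). Qed.

Lemma pi_numB x y : \pi_K (x - y) = \pi_K x - \pi_K y.
Proof. exact: (rmorphB \pi_(Quotient.quot (neg_num BZ))). Qed.

Lemma pi_numM x y : \pi_K (x * y) = \pi_K x * \pi_K y.
Proof. exact: (rmorphM \pi_(Quotient.quot (neg_num BZ))). Qed.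

Lemma pi_num1 : \pi_K 1 = 1.
Proof. exact: (rmorph1 \pi_(Quotient.quot (neg_num BZ))). Qed.

Lemma mod_fun_smooth U e : smooth (U e).
Proof. by have /moderate_fun_predP[] := mod_fun_netP U. Qed.

Lemma mod_fun_derivable U e x : derivable (U e) x 1.
Proof. exact: smooth_derivable (@mod_fun_smooth U e). Qed.

Lemma mod_fun_ext U V : (forall e t, U e t = V e t) -> U = V.
Proof. by move=> UV; apply/val_inj/funext => e; apply/funext => t; exact: UV. Qed.

Lemma mod_num_ext (x y : mod_num B) : (forall e, x e = y e) -> x = y.
Proof. by move=> xy; apply/val_inj/funext. Qed.

Lemma gen_deriveB : zmod_morphism deriv.
Proof.
move=> u v; rewrite -[u]reprK -[v]reprK -pi_funB !gen_deriveE -pi_funB.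
congr (\pi_G _); apply: mod_fun_ext => e t.
have su := @mod_fun_derivable (repr u) e.
have sv := @mod_fun_derivable (repr v) e.
exact: (congr1 (fun f => f t) (derive1_sub su sv)).
Qed.

HB.instance Definition _ := GRing.isZmodMorphism.Build G G deriv gen_deriveB.

Lemma gen_deriveM u v : deriv (u * v) = deriv u * v + u * deriv v.
Proof.
rewrite -[u]reprK -[v]reprK -pi_funM !gen_deriveE -!pi_funM -pi_funD.
congr (\pi_G _); apply: mod_fun_ext => e t.
have su := @mod_fun_derivable (repr u) e.
have sv := @mod_fun_derivable (repr v) e.
exact: (congr1 (fun f => f t) (derive1_mul su sv)).
Qed.

Lemma gen_derive_cst x : deriv (gcst x) = 0.
Proof.
rewrite -[x]reprK gen_cstE gen_deriveE.
rewrite -[0](rmorph0 \pi_(Quotient.quot (neg_fun BZ))).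
congr (\pi_G _); apply: mod_fun_ext => e t; exact: derive1_cst.
Qed.

Lemma gen_evalB t : zmod_morphism (eval t).
Proof.
move=> u v; rewrite -[u]reprK -[v]reprK -pi_funB !gen_evalE -pi_numB.
by congr (\pi_K _); exact: mod_num_ext.
Qed.

Lemma gen_eval_monoid t : monoid_morphism (eval t).
Proof.
split=> [|u v].
  rewrite -[1](rmorph1 \pi_(Quotient.quot (neg_fun BZ))) gen_evalE -pi_num1.
  by congr (\pi_K _); exact: mod_num_ext.
rewrite -[u]reprK -[v]reprK -pi_funM !gen_evalE -pi_numM.
by congr (\pi_K _); exact: mod_num_ext.
Qed.

HB.instance Definition _ t := GRing.isZmodMorphism.Build G K (eval t) (gen_evalB t).
HB.instance Definition _ t :=
  GRing.isMonoidMorphism.Build G K (eval t) (gen_eval_monoid t).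

Lemma gen_eval_cst t x : eval t (gcst x) = x.
Proof.
rewrite -[x]reprK gen_cstE gen_evalE.
by congr (\pi_K _); exact: mod_num_ext.
Qed.

(** This replaces variation of constants in the uniqueness argument, and also
    proves identities between matrices of generalized functions. *)
Lemma gen_fun_derive_inj t0 u v : deriv u = deriv v -> eval t0 u = eval t0 v ->
  u = v.
Proof.
rewrite -[u]reprK -[v]reprK !gen_deriveE !gen_evalE.
move: (repr u) (repr v) => U V /eqP/gen_funP dUV /eqP/gen_numP UV0.
apply/eqP/gen_funP; apply: (negligible_fun_primitive (t0 := t0)) => [e||//].
  exact: (@mod_fun_smooth (U - V) e).
move: dUV; congr negligible_fun; apply/funext => e.
have su := @mod_fun_derivable U e.
have sv := @mod_fun_derivable V e.
exact/esym/(derive1_sub su sv).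
Qed.

Lemma gen_derive1 : deriv 1 = 0.
Proof.
apply: (addrI (deriv 1)); rewrite addr0 -[in RHS](mulr1 1) gen_deriveM.
by rewrite mulr1 mul1r.
Qed.

Lemma gen_cstN x : gcst (- x) = - gcst x.
Proof.
apply: (@gen_fun_derive_inj 0); first by rewrite raddfN /= !gen_derive_cst oppr0.
by rewrite raddfN /= !gen_eval_cst.
Qed.

Lemma mx_gen_fun_derive_inj t0 m n (u v : 'M[G]_(m, n)) :
  map_mx deriv u = map_mx deriv v -> map_mx (eval t0) u = map_mx (eval t0) v ->
  u = v.
Proof.
move=> /matrixP duv /matrixP uv; apply/matrixP => i j.
by apply: (@gen_fun_derive_inj t0); [move: (duv i j)|move: (uv i j)]; rewrite !mxE.
Qed.

Lemma mx_gen_deriveM m n p (u : 'M[G]_(m, n)) (v : 'M[G]_(n, p)) :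
  map_mx deriv (u *m v) = map_mx deriv u *m v + u *m map_mx deriv v.
Proof.
apply/matrixP => i j; rewrite !mxE raddf_sum -big_split; apply: eq_bigr => k _.
by rewrite /= gen_deriveM !mxE.
Qed.

Lemma mx_gen_derive_cst m n (x : 'M[K]_(m, n)) : map_mx deriv (map_mx gcst x) = 0.
Proof. by apply/matrixP => i j; rewrite !mxE gen_derive_cst. Qed.

Lemma mx_gen_eval_cst t m n (x : 'M[K]_(m, n)) :
  map_mx (eval t) (map_mx gcst x) = x.
Proof. by apply/matrixP => i j; rewrite !mxE gen_eval_cst. Qed.

Lemma mx_gen_derive1 n : map_mx deriv (1%:M : 'M[G]_n) = 0.
Proof.
apply/matrixP => i j; rewrite !mxE.
by case: eqVneq => _; rewrite ?gen_derive1 ?raddf0.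
Qed.

Lemma mod_fun_sumE (J : finType) (U_ : J -> mod_fun B) e t :
  (\sum_j U_ j) e t = \sum_j U_ j e t.
Proof. exact: (big_morph (fun U : mod_fun B => U e t)). Qed.

(** The entries of E are represented by those of exp((t - t0) M_e), where M_e is
    made of representatives of A moderate for B0. *)
Lemma gen_mx_exp_exists (B0 : asymptotic_gauge R I) t0 d (A : 'M[K]_d) :
  moderate (exp_gauge B0) `<=` moderate B -> gen_mx_bounded B0 A ->
  exists2 E : 'M[G]_d, map_mx deriv E = E *m map_mx gcst A &
                       map_mx (eval t0) E = 1%:M.
Proof.
move=> expB0 bA.
have /choice[y hy] (p : 'I_d * 'I_d) :
    exists y : mod_num B, moderate B0 y /\ \pi_K y = A p.1 p.2.
  by have [z] := bA p.1 p.2; exists z.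
pose M e : 'M[R]_d := \matrix_(i, j) y (i, j) e.
pose a i j e n := (M e ^+ n) i j.
have aN i j e : geometrically_bounded (a i j e) 1 (mx_norm1 (M e)).
  exact: mx_exp_bounded.
have mN : moderate B0 (fun e => mx_norm1 (M e)).
  apply: moderate_sum => i; apply: moderate_sum => j.
  by apply: moderate_le (hy (i, j)).1 => e; rewrite mxE normr_id.
have mf i j : moderate_fun B (fun e t => egf (a i j e) (t - t0)).
  apply: moderate_fun_egf (aN i j) _ => [e|T _]; first exact: mx_norm1_ge0.
  by apply: (moderate_expR expB0); exact: moderateM mN (moderate_cst _ _).
pose U i j : mod_fun B := ModFun (introT (moderate_fun_predP _ _) (mf i j)).
exists (\matrix_(i, j) \pi_G (U i j)); apply/matrixP => i j; rewrite !mxE.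
  rewrite gen_deriveE; under eq_bigr => k _ do
    rewrite !mxE -(hy (k, j)).2 gen_cstE -pi_funM.
  rewrite -pi_fun_sum; congr (\pi_G _); apply: mod_fun_ext => e t.
  rewrite mod_fun_sumE.
  transitivity (egf (fun n => \sum_k a i k e n * y (k, j) e) (t - t0)).
    have -> : (fun n => \sum_k a i k e n * y (k, j) e) = (fun n => a i j e n.+1).
      apply/funext => n; rewrite /a exprSr mxE; apply: eq_bigr => k _.
      by rewrite [M e k j]mxE.
    rewrite /= derive1E; have := is_derive_egf_shift t0 t (aN i j e).
    by move=> h; exact: derive_val.
  exact: egf_sum (fun k => aN i k e).
rewrite gen_evalE -pi_num1.
have -> : \pi_K (1 : mod_num B) *+ (i == j) = \pi_K ((i == j)%:R).
  exact/esym/(rmorphMn \pi_(Quotient.quot (neg_num BZ))).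
congr (\pi_K _); apply: mod_num_ext => e.
rewrite /= subrr egf0 /a expr0 mxE.
by case: eqVneq.
Qed.

End GeneralizedCalculus.

(** * The linear Cauchy problem *)

Theorem theorem51 (R : realType) (I : index_set)
    (B B' Z' : asymptotic_gauge R I)
    (expB_sub : moderate (exp_gauge B) `<=` moderate B')
    (B'_sub : moderate B' `<=` moderate Z')
    (d : nat) (d_gt0 : (0 < d)%N) (t0 : R)
    (c : 'cV[gen_num B'_sub]_d) (A : 'M[gen_num B'_sub]_d)
    (c_bounded : gen_mx_bounded B c) (A_bounded : gen_mx_bounded B A) :
  exists! x : 'cV[gen_fun B'_sub]_d,
    map_mx (@gen_derive _ _ _ _ B'_sub) x +
      map_mx (@gen_cst _ _ _ _ B'_sub) A *m x = 0 /\
    map_mx (@gen_eval _ _ _ _ B'_sub t0) x = c.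
Proof.
have [E dE E0] := gen_mx_exp_exists t0 expB_sub A_bounded.
have NAT_bounded : gen_mx_bounded B (- A^T).
  move=> i j; have [y By yA] := A_bounded j i; exists (- y).
    by apply: moderate_le By => e; rewrite [(- y) e]/(- y e) normrN.
  by rewrite !mxE -yA; exact: (rmorphN \pi_(Quotient.quot (neg_num B'_sub))).
have [F dF F0] : exists2 F : 'M[gen_fun B'_sub]_d,
    map_mx (@gen_derive _ _ _ _ B'_sub) F =
      - (map_mx (@gen_cst _ _ _ _ B'_sub) A *m F) &
    map_mx (@gen_eval _ _ _ _ B'_sub t0) F = 1%:M.
  (* Transposing E' = - E A^T puts the coefficient matrix on the left. *)
  have [F dF F0] := gen_mx_exp_exists t0 expB_sub NAT_bounded.
  exists F^T; last by rewrite -map_trmx F0 trmx1.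
  rewrite -map_trmx dF trmx_mul -mulNmx; congr (_ *m _).
  by apply/matrixP => i j; rewrite !mxE gen_cstN.
have EF : E *m F = 1%:M.
  apply: (@mx_gen_fun_derive_inj _ _ _ _ _ t0).
    by rewrite mx_gen_deriveM dE dF mx_gen_derive1 mulmxN mulmxA subrr.
  by rewrite !map_mxM /= E0 F0 mulmx1 map_mx1.
exists (F *m map_mx (@gen_cst _ _ _ _ B'_sub) c); split.
  split; last by rewrite map_mxM /= F0 mul1mx mx_gen_eval_cst.
  by rewrite mx_gen_deriveM mx_gen_derive_cst mulmx0 addr0 dF mulNmx mulmxA addNr.
move=> x [dx x0].
have Ex : E *m x = map_mx (@gen_cst _ _ _ _ B'_sub) c.
  apply: (@mx_gen_fun_derive_inj _ _ _ _ _ t0).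
    by rewrite mx_gen_deriveM dE mx_gen_derive_cst -mulmxA -mulmxDr addrC dx mulmx0.
  by rewrite map_mxM /= E0 mul1mx x0 mx_gen_eval_cst.
by rewrite -Ex mulmxA (mulmx1C EF) mul1mx.
Qed.
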